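(* Let $R_n^{\mathrm{cyc}}:=\max_{g\in\mathcal K_n}\frac{2}{n}\sum_{k=0}^{n/2-1}\max_{e\in\mathtt M_k}|\widehat g(e)|$, where $\mathtt M_0,\dots,\mathtt M_{n/2-1}$ are the $n/2$ cyclic perfect matchings of $[n]$ $$\mathtt M_k=\Big\{\big\{i,\ \tfrac n2+1+\big((i+k-1)\bmod\tfrac n2\big)\big\}:1\le i\le\tfrac n2\Big\},\qquad k\in\{0,\dots,\tfrac n2-1\}.$$ Then $R_6^{\mathrm{cyc}}=\frac23$ and $R_8^{\mathrm{cyc}}=\frac12$. Consequently, when Bob's input matching is drawn uniformly from $\{\mathtt M_0,\dots,\mathtt M_{n/2-1}\}$ only, the optimal success probability of parity-oblivious protocols in operational theories admitting a preparation-noncontextual ontological model is $\frac56$ for $n=6$ (three matchings) and $\frac34$ for $n=8$ (four matchings).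
   Context: Let $n$ be even, $[n]=\{1,\dots,n\}$, $\mathcal F_n=\{S\subseteq[n]:|S|\neq0,2\}$. For $g:\{\pm1\}^n\to\mathbb R$ let $\widehat g(S)=2^{-n}\sum_{\varepsilon\in\{\pm1\}^n}g(\varepsilon)\prod_{i\in S}\varepsilon_i$. Let $\mathcal K_n$ be the set of $g:\{\pm1\}^n\to\mathbb R$ with $g\ge0$ pointwise, $\widehat g(\emptyset)=1$, and $\widehat g(S)=0$ for all $S\in\mathcal F_n$. An operational theory consists of preparations and measurements with outcome distributions $p(k\mid P,M)$; probabilistic mixtures of preparations are preparations. An ontological model is a measurable space $\Lambda$ with probability measures $\mu_P$ (respecting mixtures: $\mu_{\sum_\alpha w_\alpha P_\alpha}=\sum_\alpha w_\alpha\mu_{P_\alpha}$) and measurable response functions $\xi(k\mid\lambda,M)\in[0,1]$, $\sum_k\xi(k\mid\lambda,M)=1$, with $p(k\mid P,M)=\int\xi(k\mid\lambda,M)\,d\mu_P(\lambda)$; it is preparation noncontextual if $\mu_P=\mu_{P'}$ whenever $p(k\mid P,M)=p(k\mid P',M)$ for all $M,k$. In the restricted task, a protocol consists of a preparation $P_x$ for each $x\in\{0,1\}^n$ and, for each $\mathtt M_k$, a measurement with outcomes $(\{i,j\},b)$, $\{i,j\}\in\mathtt M_k$, $b\in\{0,1\}$; the output is correct if $b=x_i\oplus x_j$. It is parity-oblivious if for all $S\in\mathcal F_n$, all measurements $M$ of the theory and outcomes $k$, $p(k\mid P_{S,0},M)=p(k\mid P_{S,1},M)$, where $P_{S,b}$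 samples $x$ uniformly from $\{x:\bigoplus_{i\in S}x_i=b\}$ and implements $P_x$. The success probability is the probability of a correct output for $x$ uniform on $\{0,1\}^n$ and the matching independent and uniform on $\{\mathtt M_0,\dots,\mathtt M_{n/2-1}\}$. The optimal success probability is the supremum over all such theories and protocols. *)

(* Defs.v *)
From HB Require Import structures.
From mathcomp Require Import all_boot all_order all_algebra.
From mathcomp Require Import all_classical all_reals all_analysis.

Set Implicit Arguments.
Unset Strict Implicit.
Unset Printing Implicit Defensive.

Import Order.TTheory GRing.Theory Num.Theory.
Local Open Scope classical_set_scope.
Local Open Scope ring_scope.

(* Bit strings, and also the sign cube {+1,-1}^n: the bit string x stands for
   the sign vector with coordinates (-1)^(x i). The element i : 'I_n stands for
   i + 1 in {1, ..., n}. *)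
Definition cube (n : nat) := {ffun 'I_n -> bool}.

Definition fourier (R : realType) (n : nat) (g : cube n -> R)
    (S : {set 'I_n}) : R :=
  (2 ^+ n)^-1 * \sum_(x : cube n) g x * \prod_(i in S) (-1) ^+ x i.

Definition oblivious_family (n : nat) : {set {set 'I_n}} :=
  [set S : {set 'I_n} | (#|S| != 0%N) && (#|S| != 2%N)].

Definition feasible (R : realType) (n : nat) : set (cube n -> R) :=
  [set g | [/\ forall x, 0 <= g x,
               fourier g (finset.set0 : {set 'I_n}) = 1 &
               forall S : {set 'I_n}, S \in oblivious_family n ->
                 fourier g S = 0]].

(* In 0-based indices, the edge of i in the k-th cyclic matching is
   {i, n/2 + ((i + k) mod n/2)} with 0 <= i < n/2. *)
Definition cyclic_matching (n k : nat) : {set {set 'I_n}} :=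
  [set e : {set 'I_n} | [exists i : 'I_n, exists j : 'I_n,
     [&& (i < n./2)%N, nat_of_ord j == (n./2 + (i + k) %% n./2)%N
       & e == [set i; j]%SET]]]%SET.

Definition cyclic_value (R : realType) (n : nat) (g : cube n -> R) : R :=
  2 / n%:R * \sum_(k < n./2)
    \big[Num.max/0]_(e in cyclic_matching n k) `|fourier g e|.

Definition is_maximum (R : realType) (A : set R) (v : R) : Prop :=
  A v /\ ubound A v.

Definition is_Rcyc (R : realType) (n : nat) (v : R) : Prop :=
  is_maximum [set cyclic_value g | g in @feasible R n] v.

Definition is_weight (R : realType) (I : finType) (w : I -> R) : Prop :=
  (forall i, 0 <= w i) /\ \sum_i w i = 1.

(* [mix w P] is the mixture of the preparations [P i] with weights [w i]; it is
   unconstrained when [w] is not a probability vector. *)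
Record operational_theory (R : realType) := OperationalTheory {
  prep : Type;
  meas : Type;
  outcome : meas -> countType;
  prob : forall M : meas, outcome M -> prep -> R;
  mix : forall I : finType, (I -> R) -> (I -> prep) -> prep;
  prob_ge0 : forall (M : meas) (k : outcome M) (P : prep), 0 <= prob k P;
  prob_sum1 : forall (M : meas) (P : prep),
    (\esum_(k in [set: outcome M]) (prob k P)%:E = 1)%E;
  prob_mix : forall (I : finType) (w : I -> R) (P : I -> prep), is_weight w ->
    forall (M : meas) (k : outcome M),
      prob k (mix w P) = \sum_i w i * prob k (P i)
}.

(* Set functions of type [probability] are only meaningful on measurable sets,
   so equality of measures is always stated on measurable sets. *)
Record ontological_model (R : realType) (T : operational_theory R) :=
  OntologicalModel {
  ontic_display : measure_display;
  ontic : measurableType ontic_display;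
  state : prep T -> probability ontic R;
  response : forall M : meas T, outcome M -> ontic -> R;
  state_mix : forall (I : finType) (w : I -> R) (P : I -> prep T),
    is_weight w -> forall A : set ontic, measurable A ->
      (state (mix w P) A = \sum_i (w i)%:E * state (P i) A)%E;
  response_measurable : forall (M : meas T) (k : outcome M),
    measurable_fun [set: ontic] (response k);
  response_ge0_le1 : forall (M : meas T) (k : outcome M) (l : ontic),
    0 <= response k l <= 1;
  response_sum1 : forall (M : meas T) (l : ontic),
    (\esum_(k in [set: outcome M]) (response k l)%:E = 1)%E;
  response_prob : forall (M : meas T) (k : outcome M) (P : prep T),
    ((prob k P)%:E = \int[state P]_l (response k l)%:E)%E
}.

Definition op_equiv (R : realType) (T : operational_theory R)
    (P P' : prep T) : Prop :=
  forall (M : meas T) (k : outcome M), prob k P = prob k P'.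

Definition preparation_noncontextual (R : realType) (T : operational_theory R)
    (O : ontological_model T) : Prop :=
  forall P P' : prep T, op_equiv P P' ->
    forall A : set (ontic O), measurable A -> state O P A = state O P' A.

(* [label k] identifies the outcomes of the k-th measurement with the pairs
   (edge of the k-th matching, bit). *)
Record protocol (R : realType) (n : nat) (T : operational_theory R) :=
  Protocol {
  encode : cube n -> prep T;
  query : 'I_n./2 -> meas T;
  label : forall k : 'I_n./2,
    {e : {set 'I_n} | e \in cyclic_matching n k} * bool -> outcome (query k);
  label_bij : forall k : 'I_n./2, bijective (@label k)
}.

Definition parity (n : nat) (S : {set 'I_n}) (x : cube n) : bool :=
  \big[addb/false]_(i in S) x i.

Definition uniform_weight (R : realType) (I : finType) (A : {set I}) (i : I) : R :=
  (i \in A)%:R / #|A|%:R.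

Definition parity_prep (R : realType) (n : nat) (T : operational_theory R)
    (Q : protocol n T) (S : {set 'I_n}) (b : bool) : prep T :=
  mix (uniform_weight R [set x : cube n | parity S x == b]%SET) (encode Q).

Definition parity_oblivious (R : realType) (n : nat) (T : operational_theory R)
    (Q : protocol n T) : Prop :=
  forall S : {set 'I_n}, S \in oblivious_family n ->
    op_equiv (parity_prep Q S false) (parity_prep Q S true).

Definition success (R : realType) (n : nat) (T : operational_theory R)
    (Q : protocol n T) : R :=
  (2 ^+ n)^-1 * \sum_(x : cube n) (n./2)%:R^-1 * \sum_(k < n./2)
    \sum_(o : {e : {set 'I_n} | e \in cyclic_matching n k} * bool
            | o.2 == parity (val o.1) x)
      prob (label Q o) (encode Q x).

(* [sup] is 0 on sets without a supremum, so a nonzero value is a genuine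
   supremum. *)
Definition optimal_success (R : realType) (n : nat) : R :=
  sup [set s | exists (T : operational_theory R) (Q : protocol n T),
    [/\ exists O : ontological_model T, preparation_noncontextual O,
        parity_oblivious Q & s = success Q]].

(* Main.v *)
Require Import Defs.
From HB Require Import structures.
From mathcomp Require Import all_boot all_order all_algebra.
From mathcomp Require Import all_classical all_reals all_analysis.
From mathcomp Require Import measurable_realfun.
From mathcomp Require Import ring lra.
Import Order.TTheory GRing.Theory Num.Theory.
Local Open Scope ring_scope.

Set Implicit Arguments.
Unset Strict Implicit.
Unset Printing Implicit Defensive.

(** Upper bound on [R_n^cyc]: if [w >= 0] on the cube, then [E[g w] >= 0]. When
    the Fourier expansion of [w] has constant term 2, coefficient [-s_e] with
    [s_e = 1] or [-1] at each of four chosen edges [e], and otherwise only terms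
    of degree 4 and 6, this reads [sum_e s_e ghat(e) <= 2] for every feasible
    [g]. Picking one edge in each cyclic matching gives distinct edges of a
    bipartite graph, and such a [w] exists for any four of those. The value 2 is
    attained by [g = 1 + a b + a c + b c] for three of the signs.

    Success probability: at an ontic state [l], the responses are a mixture of
    deterministic strategies [sigma] with weights [q sigma l]. By obliviousness
    and noncontextuality, [x |-> int (q sigma) d mu_x] is a nonnegative multiple
    of a feasible function, so no Radon-Nikodym densities are needed to bound the
    success of [sigma] by [(1 + R_n^cyc) / 2]. Conversely, with [m = n/2], a
    classical system revealing the two bits [x_0 + x_m] and [x_0 + x_(m+1)] is
    oblivious, answers the first two matchings with certainty and has to guess
    for the others. *)

(** * Dual certificates *)

Section Fourier.
Variables (R : realType) (n : nat).
Implicit Types (g : cube n -> R) (s : seq 'I_n) (x : cube n).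

(** Characters are indexed by sequences rather than sets, so that explicit certificates unfold by
    [big_cons]. *)
Definition chi s (x : cube n) : R := \prod_(i <- s) (-1) ^+ x i.

Lemma chi_set s x : uniq s ->
  \prod_(i in [set:: s]%SET) (-1) ^+ x i = chi s x.
Proof.
move=> us; rewrite /chi (eq_bigl (mem s)); first by rewrite -big_uniq.
by move=> i; rewrite inE.
Qed.

Lemma fourier_chi g s : uniq s ->
  fourier g [set:: s]%SET = (2 ^+ n)^-1 * \sum_x g x * chi s x.
Proof.
by move=> us; rewrite /fourier; congr (_ * _); apply: eq_bigr => x _; rewrite chi_set.
Qed.

Lemma card_set_uniq s : uniq s -> #|[set:: s]%SET| = size s.
Proof. by move=> us; rewrite cardsE; apply/card_uniqP. Qed.

(** Exchanging the sums shows that the pairing is the average over the cube of [g] times the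
    function with expansion [ts], a product of nonnegative functions. *)
Lemma fourier_pairing_ge0 g (ts : seq (R * seq 'I_n)) :
  (forall x, 0 <= g x) -> all (fun t => uniq t.2) ts ->
  (forall x, 0 <= \sum_(t <- ts) t.1 * chi t.2 x) ->
  0 <= \sum_(t <- ts) t.1 * fourier g [set:: t.2]%SET.
Proof.
move=> g0 /allP uts w0.
have -> : \sum_(t <- ts) t.1 * fourier g [set:: t.2]%SET
    = (2 ^+ n)^-1 * \sum_x g x * \sum_(t <- ts) t.1 * chi t.2 x.
  rewrite big_seq_cond (eq_bigr (fun t => \sum_x (2 ^+ n)^-1 * (g x * (t.1 * chi t.2 x)))).
    rewrite -big_seq_cond exchange_big /= mulr_sumr; apply: eq_bigr => x _.
    by rewrite -mulr_sumr; congr (_ * _); rewrite -mulr_sumr.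
  move=> t /andP[tts _]; rewrite fourier_chi ?uts// mulrCA mulr_sumr mulr_sumr.
  by apply: eq_bigr => x _; congr (_ * _); rewrite mulrCA.
apply: mulr_ge0; first by rewrite invr_ge0 exprn_ge0.
by apply: sumr_ge0 => x _; apply: mulr_ge0.
Qed.

(** Signs chosen this way turn each certificate, stated for signed coefficients, into a bound on
    absolute values. *)
Lemma exists_sign (c : R) : exists b : bool, (-1) ^+ b * c = - `|c|.
Proof.
case: (ger0P c) => h; [exists true | exists false];
  rewrite ?expr1 ?mulN1r ?expr0 ?mul1r//; lra.
Qed.

Section Feasible.
Variable g : cube n -> R.
Hypothesis g_feasible : feasible g.

Let coef (i j : 'I_n) := fourier g [set i; j]%SET.

Lemma feasible_ge0 x : 0 <= g x.
Proof. by case: g_feasible => ? _ _. Qed.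

Lemma feasible_set0 : fourier g [set:: [::]]%SET = 1.
Proof.
case: g_feasible => _ <- _; congr (fourier g _).
Qed.

Lemma feasible_set2 (i j : 'I_n) : fourier g [set:: [:: i; j]]%SET = coef i j.
Proof. by congr (fourier g _); apply/setP => k; rewrite !inE. Qed.

Lemma feasible_oblivious s : uniq s -> (2 < size s)%N ->
  fourier g [set:: s]%SET = 0.
Proof.
case: g_feasible => _ _ g_oblivious us s2; apply: g_oblivious.
by rewrite inE card_set_uniq//; case: (size s) s2 => [|[|[]]].
Qed.

Lemma coefC (i j : 'I_n) : coef i j = coef j i.
Proof. by rewrite /coef finset.setUC. Qed.

(** This is weak duality: pairing [g] with the weight leaves the constant term and the edge terms,
    because the terms [qs] have degree above 2 and [g] has no such coefficients. *)
Lemma dual_bound (w0 : R) (ps : seq (bool * ('I_n * 'I_n))) (qs : seq (R * seq 'I_n)) :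
  all (fun p => p.2.1 != p.2.2) ps ->
  all (fun q => uniq q.2 && (2 < size q.2)%N) qs ->
  (forall x : cube n,
     0 <= w0 + \sum_(p <- ps) (-1) ^+ p.1 * ((-1) ^+ x p.2.1 * (-1) ^+ x p.2.2)
          + \sum_(q <- qs) q.1 * chi q.2 x) ->
  - \sum_(p <- ps) (-1) ^+ p.1 * coef p.2.1 p.2.2 <= w0.
Proof.
move=> /allP ps_ne /allP qs_ok w_ge0.
pose ts : seq (R * seq 'I_n) := (w0, [::]) ::
  [seq ((-1) ^+ p.1, [:: p.2.1; p.2.2]) | p : bool * ('I_n * 'I_n) <- ps] ++ qs.
have ts_uniq : all (fun t => uniq t.2) ts.
  rewrite /= all_cat all_map; apply/andP; split; [apply/allP => p | apply/allP => q].
    by move=> /ps_ne; rewrite /= inE andbT.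
  by move=> /qs_ok/andP[].
have qs0 : \sum_(q <- qs) q.1 * fourier g [set:: q.2]%SET = 0.
  rewrite big_seq big1// => q /qs_ok/andP[uq sq].
  by rewrite feasible_oblivious ?mulr0.
have := fourier_pairing_ge0 feasible_ge0 ts_uniq.
rewrite big_cons big_cat big_map /= qs0 addr0 feasible_set0 mulr1.
under eq_bigr do rewrite feasible_set2.
move=> H; rewrite lerNl -subr_ge0 opprK addrC; apply: H => x.
rewrite big_cons big_cat big_map {1}/chi big_nil /= mulr1 addrA.
under eq_bigr do rewrite /chi !big_cons big_nil mulr1.
exact: w_ge0.
Qed.

Ltac split_uniq := rewrite /= !inE ?negb_or -?andbA;
  repeat (case/andP; let h := fresh "ne" in move=> h).
Ltac use_uniq := rewrite /= ?inE ?negb_or -?andbA ?andbT;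
  repeat (apply/andP; split=> //); by rewrite // eq_sym.

(** The weight is the product [(1 + s x_a x_b) (1 + t x_c x_d)], whose only further term has degree
    4. *)
Lemma coef_pair_le (a b c d : 'I_n) : uniq [:: a; b; c; d] ->
  `|coef a b| + `|coef c d| <= 1.
Proof.
split_uniq => _.
have [s e1] := exists_sign (coef a b); have [t e2] := exists_sign (coef c d).
have := @dual_bound 1 [:: (s, (a, b)); (t, (c, d))]
  [:: ((-1) ^+ s * (-1) ^+ t, [:: a; b; c; d])].
rewrite /= !big_cons !big_nil e1 e2 => H.
rewrite -[leLHS]opprK; suff : - (- `|coef a b| + (- `|coef c d| + 0)) <= 1 by lra.
apply: H; [use_uniq | use_uniq | move=> x].
have key (p q : bool) : 0 <= (1 + (-1) ^+ p) * (1 + (-1) ^+ q) :> R.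
  by apply: mulr_ge0; [case: p | case: q]; rewrite /= ?expr1 ?expr0; lra.
have := key (s (+) x a (+) x b) (t (+) x c (+) x d).
rewrite /chi !big_cons !big_nil /= !signr_addb; lra.
Qed.

(* Up to sign switches, the weight is twice the density of the law in which [a],
   [b], [d] are independent uniform signs, [o] is their majority and the pair
   [p], [q] is independent of them with correlation [1/2]. *)
Lemma coef_star3_edge_le (o a b d p q : 'I_n) : uniq [:: o; a; b; d; p; q] ->
  `|coef o a| + `|coef o b| + `|coef o d| + `|coef p q| <= 2.
Proof.
split_uniq => _.
have [sa ea] := exists_sign (coef o a); have [sb eb] := exists_sign (coef o b).
have [sd ed] := exists_sign (coef o d); have [sp ep] := exists_sign (coef p q).
pose A : R := (-1) ^+ sa; pose B : R := (-1) ^+ sb.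
pose D : R := (-1) ^+ sd; pose P : R := (-1) ^+ sp.
have := @dual_bound 2 [:: (sa, (o, a)); (sb, (o, b)); (sd, (o, d)); (sp, (p, q))]
  [:: (- (A * B * D), [:: o; a; b; d]);
      (A * P / 2, [:: o; a; p; q]); (B * P / 2, [:: o; b; p; q]);
      (D * P / 2, [:: o; d; p; q]);
      (- (A * B * D * P / 2), [:: o; a; b; d; p; q])].
rewrite /= !big_cons !big_nil ea eb ed ep => H.
have {}H := H _ _ _; suff : - (- `|coef o a| + (- `|coef o b| + (- `|coef o d| +
  (- `|coef p q| + 0)))) <= 2 by lra.
apply: H; [use_uniq | use_uniq | move=> x].
(* Since [a' + b' + d' - a' b' d'] is twice the majority of three signs, this factor is
   [2 (1 + o' maj)]. *)
have key1 (u v w z : bool) :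
    let o' := (-1) ^+ u in let a' := (-1) ^+ v in let b' := (-1) ^+ w in
    let d' := (-1) ^+ z : R in
    0 <= 2 + o' * a' + o' * b' + o' * d' - o' * a' * b' * d'.
  by case: u; case: v; case: w; case: z;
    rewrite /= ?expr1 ?expr0 ?(mulr1, mul1r, mulrN, mulNr); lra.
have key2 (u : bool) : 0 <= 1 + (-1) ^+ u / 2 :> R.
  by case: u; rewrite /= ?expr1 ?expr0 ?(mulr1, mul1r, mulrN, mulNr); lra.
have := mulr_ge0 (key1 (x o) (sa (+) x a) (sb (+) x b) (sd (+) x d))
                 (key2 (sp (+) x p (+) x q)).
rewrite /chi !big_cons !big_nil /= !signr_addb /A /B /D /P; lra.
Qed.

(* As above without [p], [q], but with [f = d] if [a = b] and [f] a fresh uniform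
   sign otherwise. *)
Lemma coef_spider_le (o a b d f : 'I_n) : uniq [:: o; a; b; d; f] ->
  `|coef o a| + `|coef o b| + `|coef o d| + `|coef d f| <= 2.
Proof.
split_uniq => _.
have [sa ea] := exists_sign (coef o a); have [sb eb] := exists_sign (coef o b).
have [sd ed] := exists_sign (coef o d); have [t] := exists_sign (coef d f).
(* The sign of the edge from [d] to [f] is split as [sd (+) sf]: switching [d] by [sd] and [f] by
   [sf] then makes all four edge signs positive at once. *)
rewrite -[t](addKb sd); move: (sd (+) t) => sf ef.
pose A : R := (-1) ^+ sa; pose B : R := (-1) ^+ sb.
pose D : R := (-1) ^+ sd; pose F : R := (-1) ^+ sf.
have := @dual_bound 2 [:: (sa, (o, a)); (sb, (o, b)); (sd, (o, d)); (sd (+) sf, (d, f))]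
  [:: (- (A * B * D), [:: o; a; b; d]); (A * B * D * F, [:: a; b; d; f]);
      (A * D * F, [:: o; a; d; f]); (B * D * F, [:: o; b; d; f])].
rewrite /= !big_cons !big_nil ea eb ed ef => H.
suff : - (- `|coef o a| + (- `|coef o b| + (- `|coef o d| +
  (- `|coef d f| + 0)))) <= 2 by lra.
apply: H; [use_uniq | use_uniq | move=> x].
(* With [maj] the majority of [a'], [b'], [d'], this is [(1 + o' maj) (2 + (1 + a' b') d' f')],
   since [maj = a'] whenever [a' = b']. *)
have key (u v w z y : bool) :
    let o' := (-1) ^+ u in let a' := (-1) ^+ v in let b' := (-1) ^+ w in
    let d' := (-1) ^+ z in let f' := (-1) ^+ y : R in
    0 <= 2 + o' * a' + o' * b' + o' * d' + d' * f' - o' * a' * b' * d'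
         + a' * b' * d' * f' + o' * a' * d' * f' + o' * b' * d' * f'.
  by case: u; case: v; case: w; case: z; case: y;
    rewrite /= ?expr1 ?expr0 ?(mulr1, mul1r, mulrN, mulNr); lra.
have := key (x o) (sa (+) x a) (sb (+) x b) (sd (+) x d) (sf (+) x f).
rewrite /chi !big_cons !big_nil /= !signr_addb /A /B /D /F; lra.
Qed.

(* The leaves are uniform among the sign vectors with sum [2] or [-2], and [o]
   is half of that sum. *)
Lemma coef_star4_le (o a b d f : 'I_n) : uniq [:: o; a; b; d; f] ->
  `|coef o a| + `|coef o b| + `|coef o d| + `|coef o f| <= 2.
Proof.
split_uniq => _.
have [sa ea] := exists_sign (coef o a); have [sb eb] := exists_sign (coef o b).
have [sd ed] := exists_sign (coef o d); have [sf ef] := exists_sign (coef o f).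
pose A : R := (-1) ^+ sa; pose B : R := (-1) ^+ sb.
pose D : R := (-1) ^+ sd; pose F : R := (-1) ^+ sf.
have := @dual_bound 2 [:: (sa, (o, a)); (sb, (o, b)); (sd, (o, d)); (sf, (o, f))]
  [:: (- (2 * A * B * D * F), [:: a; b; d; f]);
      (- (A * B * D), [:: o; a; b; d]); (- (A * B * F), [:: o; a; b; f]);
      (- (A * D * F), [:: o; a; d; f]); (- (B * D * F), [:: o; b; d; f])].
rewrite /= !big_cons !big_nil ea eb ed ef => H.
suff : - (- `|coef o a| + (- `|coef o b| + (- `|coef o d| +
  (- `|coef o f| + 0)))) <= 2 by lra.
apply: H; [use_uniq | use_uniq | move=> x].
(* This factors as [(1 - a' b' d' f') (2 + o' (a' + b' + d' + f'))]; when the first factor is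
   nonzero, the four leaves sum to [2] or [-2]. *)
have key (u v w z y : bool) :
    let o' := (-1) ^+ u in let a' := (-1) ^+ v in let b' := (-1) ^+ w in
    let d' := (-1) ^+ z in let f' := (-1) ^+ y : R in
    0 <= 2 + o' * a' + o' * b' + o' * d' + o' * f' - 2 * a' * b' * d' * f'
         - o' * a' * b' * d' - o' * a' * b' * f' - o' * a' * d' * f'
         - o' * b' * d' * f'.
  by case: u; case: v; case: w; case: z; case: y;
    rewrite /= ?expr1 ?expr0 ?(mulr1, mul1r, mulrN, mulNr); lra.
have := key (x o) (sa (+) x a) (sb (+) x b) (sd (+) x d) (sf (+) x f).
rewrite /chi !big_cons !big_nil /= !signr_addb /A /B /D /F; lra.
Qed.
End Feasible.
End Fourier.


(** * Four edges of a bipartite graph *)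

Section BipartiteEdges.
Variables (R : realType) (n : nat) (g : cube n -> R).
Hypothesis g_feasible : feasible g.
Implicit Types (L : pred 'I_n) (e : 'I_n * 'I_n).

Let coef (i j : 'I_n) := fourier g [set i; j]%SET.

Lemma neq_pred L (i j : 'I_n) : L i -> ~~ L j -> (i != j) && (j != i).
Proof. by move=> Li Lj; rewrite (eq_sym j) andbb; apply: contraNneq Lj => <-. Qed.

(** If [q] is one of the leaves [a], [b], [d], the edges form a spider with a leg of length two;
    otherwise the fourth edge is disjoint from the star. *)
Lemma coef_star3_plus_le L (o p a b d q : 'I_n) :
  L o -> L p -> ~~ L a -> ~~ L b -> ~~ L d -> ~~ L q ->
  uniq [:: a; b; d] -> p != o ->
  `|coef o a| + `|coef o b| + `|coef o d| + `|coef p q| <= 2.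
Proof.
move=> Lo Lp La Lb Ld Lq.
rewrite /= !inE negb_or => /andP[/andP[ab ad] /andP[bd _]] po.
have /andP[oa ao] := neq_pred Lo La; have /andP[ob bo] := neq_pred Lo Lb.
have /andP[od do_] := neq_pred Lo Ld; have /andP[oq qo] := neq_pred Lo Lq.
have /andP[pa ap] := neq_pred Lp La; have /andP[pb bp] := neq_pred Lp Lb.
have /andP[pd dp] := neq_pred Lp Ld; have /andP[pq qp] := neq_pred Lp Lq.
have op : o != p by rewrite eq_sym.
have [qa|qa] := eqVneq q a.
  have := @coef_spider_le _ _ _ g_feasible o b d a p.
  rewrite -qa in ab ad *; rewrite -/(coef q p) -/(coef o b) -/(coef o d) -/(coef o q) /coef (coefC g q p).
  rewrite /= !inE !negb_or ob od oq op bd (eq_sym b) ab bp (eq_sym d) ad dp qp.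
  by move/(_ isT); lra.
have [qb|qb] := eqVneq q b.
  have := @coef_spider_le _ _ _ g_feasible o a d b p.
  rewrite -qb in ab bd *; rewrite /coef (coefC g q p).
  rewrite /= !inE !negb_or oa od oq op ad ab ap (eq_sym d) bd dp qp.
  by move/(_ isT); lra.
have [qd|qd] := eqVneq q d.
  have := @coef_spider_le _ _ _ g_feasible o a b d p.
  rewrite -qd in ad bd *; rewrite /coef (coefC g q p).
  rewrite /= !inE !negb_or oa ob oq op ab ad ap bd bp qp.
  by move/(_ isT); lra.
apply: (coef_star3_edge_le g_feasible).
by rewrite /= !inE !negb_or oa ob od op oq ab ad ap (eq_sym a) qa bd bp
  (eq_sym b) qb dp (eq_sym d) qd pq.
Qed.

Let w e := `|coef e.1 e.2|.
Let edge L e := L e.1 && ~~ L e.2.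

(** The fourth edge either starts at the common end as well, which gives a star with four leaves, or
    starts elsewhere. *)
Lemma common_end_le L (e0 e1 e2 e3 : 'I_n * 'I_n) : all (edge L) [:: e0; e1; e2; e3] ->
  uniq [:: e0; e1; e2; e3] -> e0.1 = e1.1 -> e0.1 = e2.1 ->
  w e0 + w e1 + w e2 + w e3 <= 2.
Proof.
case: e0 e1 e2 e3 => [u a] [u1 b] [u2 d] [p q] /= + + E1 E2.
rewrite /edge /= -{}E1 -{}E2 /w /=.
move=> /and5P[/andP[Lu La] /andP[_ Lb] /andP[_ Ld] /andP[Lp Lq] _].
rewrite !inE !negb_or !xpair_eqE eqxx /=.
move=> /and4P[/and3P[ab ad oq] /andP[bd oq'] oq'' _].
have uabd : uniq [:: a; b; d] by rewrite /= !inE negb_or ab ad bd.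
have [pu|pu] := eqVneq p u; last exact: (coef_star3_plus_le Lu Lp).
rewrite pu eqxx /= in oq oq' oq'' *; apply: (coef_star4_le g_feasible).
have /andP[ua _] := neq_pred Lu La; have /andP[ub _] := neq_pred Lu Lb.
have /andP[ud _] := neq_pred Lu Ld; have /andP[uq _] := neq_pred Lu Lq.
by rewrite /= !inE !negb_or ua ub ud uq ab ad oq bd oq' oq''.
Qed.

Let swap e := (e.2, e.1).

Lemma swap_inj : injective swap.
Proof. by case=> a b [c d] [-> ->]. Qed.

Lemma w_swap e : w (swap e) = w e.
Proof. by rewrite /w /coef coefC. Qed.

Lemma edge_swap L e : edge (predC L) (swap e) = edge L e.
Proof. by rewrite /edge /= negbK andbC. Qed.

(** Reversing every edge exchanges the two sides of the bipartition. *)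
Lemma common_right_end_le L (e0 e1 e2 e3 : 'I_n * 'I_n) : all (edge L) [:: e0; e1; e2; e3] ->
  uniq [:: e0; e1; e2; e3] -> e0.2 = e1.2 -> e0.2 = e2.2 ->
  w e0 + w e1 + w e2 + w e3 <= 2.
Proof.
move=> es us E1 E2; rewrite -(w_swap e0) -(w_swap e1) -(w_swap e2) -(w_swap e3).
apply: (@common_end_le (predC L)) => //; first by move: es; rewrite /= !edge_swap.
by rewrite -[[:: _; _; _; _]]/(map swap [:: e0; e1; e2; e3]) (map_inj_uniq swap_inj).
Qed.

Lemma edge_pairP L e f : edge L e -> edge L f -> e != f ->
  [\/ w e + w f <= 1, e.1 = f.1 /\ e.2 != f.2 | e.2 = f.2 /\ e.1 != f.1].
Proof.
case: e f => [a b] [c d]; rewrite /edge /= => /andP[La Lb] /andP[Lc Ld].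
rewrite xpair_eqE /=; have [ac bd|ac _] := eqVneq a c; first by constructor 2.
have [bd|bd] := eqVneq b d; first by constructor 3.
constructor 1; apply: (coef_pair_le g_feasible).
have /andP[ab _] := neq_pred La Lb; have /andP[ad _] := neq_pred La Ld.
have /andP[_ bc] := neq_pred Lc Lb; have /andP[cd _] := neq_pred Lc Ld.
by rewrite /= !inE !negb_or ab ac ad bc bd cd.
Qed.

(* Two disjoint edges have total weight at most 1, so one is done when the four
   edges split into two disjoint pairs. Otherwise three of the edges pairwise
   meet, and since a bipartite graph has no triangle they have a common end. *)
Lemma four_edges_le L (e0 e1 e2 e3 : 'I_n * 'I_n) : all (edge L) [:: e0; e1; e2; e3] ->
  uniq [:: e0; e1; e2; e3] -> w e0 + w e1 + w e2 + w e3 <= 2.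
Proof.
move=> es us; have := es; have := us.
rewrite /= !inE !negb_or => /and4P[/and3P[n01 n02 n03] /andP[n12 n13] n23 _].
move=> /and5P[h0 h1 h2 h3 _].
have perm_us (s : seq ('I_n * 'I_n)) : perm_eq s [:: e0; e1; e2; e3] -> uniq s /\ all (edge L) s.
  by move=> p; rewrite (perm_uniq p) us (perm_all _ p).
have left_end (a b c d : 'I_n * 'I_n) : perm_eq [:: a; b; c; d] [:: e0; e1; e2; e3] ->
    a.1 = b.1 -> a.1 = c.1 -> w a + w b + w c + w d <= 2.
  by move=> /perm_us[? ?]; exact: (@common_end_le L).
have right_end (a b c d : 'I_n * 'I_n) : perm_eq [:: a; b; c; d] [:: e0; e1; e2; e3] ->
    a.2 = b.2 -> a.2 = c.2 -> w a + w b + w c + w d <= 2.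
  by move=> /perm_us[? ?]; exact: (@common_right_end_le L).
(* Each [p_i] moves [e_i] to the last place, for the case where the other three edges have a common
   end. *)
have p3 : perm_eq [:: e0; e1; e2; e3] [:: e0; e1; e2; e3] by [].
have p2 : perm_eq [:: e0; e1; e3; e2] [:: e0; e1; e2; e3].
  by rewrite !perm_cons (perm_catC [:: e3] [:: e2]).
have p1 : perm_eq [:: e0; e2; e3; e1] [:: e0; e1; e2; e3].
  by rewrite !perm_cons (perm_catC [:: e2; e3] [:: e1]).
have p0 : perm_eq [:: e1; e2; e3; e0] [:: e0; e1; e2; e3].
  by rewrite (perm_catC [:: e1; e2; e3] [:: e0]).
have bad_ends (i j : 'I_n) : i = j -> i != j -> False by move=> -> /eqP.
have := edge_pairP h0 h1 n01; have := edge_pairP h2 h3 n23.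
have := edge_pairP h0 h2 n02; have := edge_pairP h1 h3 n13.
have := edge_pairP h0 h3 n03; have := edge_pairP h1 h2 n12.
move=> T12 T03 T13 T02 T23 T01.
have all_in : [\/ w e0 + w e1 + w e2 + w e3 <= 2,
   w e0 + w e1 + w e3 + w e2 <= 2, w e0 + w e2 + w e3 + w e1 <= 2 |
   w e1 + w e2 + w e3 + w e0 <= 2].
  have close1 : w e0 + w e1 <= 1 -> w e2 + w e3 <= 1 -> w e0 + w e1 + w e2 + w e3 <= 2 by lra.
  have close2 : w e0 + w e2 <= 1 -> w e1 + w e3 <= 1 -> w e0 + w e1 + w e2 + w e3 <= 2 by lra.
  have close3 : w e0 + w e3 <= 1 -> w e1 + w e2 <= 1 -> w e0 + w e1 + w e2 + w e3 <= 2 by lra.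
  (* Unless one of the three splittings consists of two disjoint pairs, each supplies a meeting
     pair. These three pairs either all contain one edge, which then meets two others at the same
     end, or lie among three edges, where mixed ends are contradictory. *)
  case: T01 => [c01|[E01 N01]|[E01 N01]];
  [case: T23 => [c23|[E23 N23]|[E23 N23]]; first (by constructor 1; auto) | | ];
  (case: T02 => [c02|[E02 N02]|[E02 N02]];
  [case: T13 => [c13|[E13 N13]|[E13 N13]]; first (by constructor 1; auto) | | ]);
  (case: T03 => [c03|[E03 N03]|[E03 N03]];
  [case: T12 => [c12|[E12 N12]|[E12 N12]]; first (by constructor 1; auto) | | ]);
  first
  [ by constructor 1; first [apply: left_end p3 _ _; congruence | apply: right_end p3 _ _; congruence]
  | by constructor 2; first [apply: left_end p2 _ _; congruence | apply: right_end p2 _ _; congruence]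
  | by constructor 3; first [apply: left_end p1 _ _; congruence | apply: right_end p1 _ _; congruence]
  | by constructor 4; first [apply: left_end p0 _ _; congruence | apply: right_end p0 _ _; congruence]
  | by exfalso; repeat match goal with H : is_true (_ != _) |- _ => move/eqP in H end; congruence ].
by case: all_in; lra.
Qed.
End BipartiteEdges.

(** * Extremal values *)

Section Characters.
Variables (R : realType) (n : nat).

Definition set_chi (S : {set 'I_n}) (x : cube n) : R := \prod_(i in S) (-1) ^+ x i.

Lemma set_chi_parity S x : set_chi S x = (-1) ^+ parity S x.
Proof.
by rewrite /set_chi /parity (big_morph _ (@signr_addb R) (erefl : (-1) ^+ false = 1 :> R)).
Qed.

Lemma set_chi_set0 x : set_chi finset.set0 x = 1.
Proof. by rewrite /set_chi big_set0. Qed.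

(** The sum over the cube factors over the coordinates, and a coordinate in exactly one of [S], [T]
    contributes [1 - 1 = 0]. *)
Lemma set_chi_orthogonal (S T : {set 'I_n}) :
  \sum_x set_chi S x * set_chi T x = 2 ^+ n * (S == T)%:R.
Proof.
pose F (i : 'I_n) (b : bool) : R :=
  (if i \in S then (-1) ^+ b else 1) * (if i \in T then (-1) ^+ b else 1).
have -> : \sum_(x : cube n) set_chi S x * set_chi T x = \sum_(x : cube n) \prod_i F i (x i).
  by apply: eq_bigr => x _; rewrite /set_chi big_mkcond [X in _ * X]big_mkcond -big_split.
rewrite -bigA_distr_bigA (eq_bigr (fun i => 2 * ((i \in S) == (i \in T))%:R)); last first.
  move=> i _; rewrite big_bool /F.
  by case: (i \in S); case: (i \in T); rewrite /= ?expr1 ?expr0; lra.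
rewrite big_split /= prodr_const card_ord; congr (_ * _).
have [<-|ST] := eqVneq S T; first by rewrite big1// => i _; rewrite eqxx.
have /forallPn[i iST] : ~~ [forall i, (i \in S) == (i \in T)].
  by apply: contraNN ST => /forallP ST; apply/eqP/setP => i; apply/eqP.
by rewrite (bigD1 i)//= (negPf iST) mul0r.
Qed.

Lemma sum_set_chi (S : {set 'I_n}) :
  \sum_x set_chi S x = 2 ^+ n * (S == finset.set0)%:R.
Proof.
rewrite -set_chi_orthogonal; apply: eq_bigr => x _.
by rewrite set_chi_set0 mulr1.
Qed.

Lemma fourier_sum_set_chi (Ts : seq {set 'I_n}) (S : {set 'I_n}) :
  fourier (fun x => \sum_(T <- Ts) set_chi T x) S = (count_mem S Ts)%:R.
Proof.
rewrite /fourier; under eq_bigr do rewrite mulr_suml.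
rewrite exchange_big /= -sum1_count natr_sum [RHS]big_mkcond mulr_sumr.
apply: eq_bigr => T _; rewrite set_chi_orthogonal mulrA mulVf ?mul1r; last first.
  by rewrite expf_neq0 ?pnatr_eq0.
have [->|ST] := eqVneq S T; first by rewrite /= eqxx.
by rewrite ifN //= eq_sym.
Qed.

(* This is [((a + b + c)^2 - 1) / 2] in the signs [a], [b], [c]. *)
Definition triangle (a b c : 'I_n) (x : cube n) : R :=
  \sum_(T <- [:: finset.set0; [set a; b]; [set a; c]; [set b; c]]%SET) set_chi T x.

(** A sum of three signs is odd, so its square is at least 1. *)
Lemma triangle_feasible a b c : uniq [:: a; b; c] -> feasible (triangle a b c).
Proof.
rewrite /= !inE negb_or => /andP[/andP[ab ac] /andP[bc _]]; split=> [x||S].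
- rewrite /triangle !big_cons big_nil set_chi_set0 /set_chi.
  rewrite !(big_setU1, big_set1) ?inE//=.
  by case: (x a); case: (x b); case: (x c);
    rewrite /= ?expr1 ?expr0 ?(mulr1, mul1r, mulrN, mulNr); lra.
- rewrite fourier_sum_set_chi /= eqxx.
  by rewrite -!cards_eq0 !cards2 ab ac bc.
- rewrite inE => /andP[S0 S2]; rewrite fourier_sum_set_chi /=.
  have S2' (i j : 'I_n) : i != j -> ([set i; j]%SET == S) = false.
    by move=> ij; apply: contraNF S2 => /eqP <-; rewrite cards2 ij.
  by rewrite !S2'// eq_sym -cards_eq0 (negPf S0).
Qed.

(** These are lower bounds because a coefficient is the multiplicity of a set in the list, which can
    exceed 1 when [a], [b], [c] are not distinct. *)
Lemma triangle_fourier a b c : fourier (triangle a b c) [set a; b]%SET >= 1 /\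
  fourier (triangle a b c) [set a; c]%SET >= 1.
Proof.
rewrite !fourier_sum_set_chi; split; rewrite ler1n -has_count; apply/hasP;
  [exists [set a; b]%SET | exists [set a; c]%SET] => //=; by rewrite !inE eqxx ?orbT.
Qed.

End Characters.

(** * Cyclic matchings and the sum of their maxima *)

Section Cyclic.
Variables (R : realType) (n : nat).
Local Notation m := (n./2).
Implicit Types (g : cube n -> R) (p : 'I_n * 'I_n).

(** Edges are ordered pairs with the left end first, matching the bipartition in [four_edges_le]. *)
Definition cyclic_edge k p :=
  (p.1 < m)%N && (nat_of_ord p.2 == m + (p.1 + k) %% m)%N.

Lemma cyclic_matchingP k (e : {set 'I_n}) :
  reflect (exists2 p, cyclic_edge k p & e = [set p.1; p.2]%SET)
          (e \in cyclic_matching n k).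
Proof.
rewrite inE; apply: (iffP existsP) => [[i /existsP[j /and3P[im jk /eqP ->]]]|].
  by exists (i, j) => //; apply/andP.
move=> [[i j] /andP[/= im jk] ->]; exists i; apply/existsP; exists j.
by rewrite im jk eqxx.
Qed.

Lemma cyclic_edge_ltn k p : cyclic_edge k p -> (p.1 < m)%N && ~~ (p.2 < m)%N.
Proof. by case/andP=> -> /eqP ->; rewrite -leqNgt leq_addr. Qed.

(** The two ends determine [k] modulo [m], so different matchings are edge-disjoint. *)
Lemma cyclic_edge_inj k l p : (k < m)%N -> (l < m)%N ->
  cyclic_edge k p -> cyclic_edge l p -> k = l.
Proof.
move=> km lm /andP[_ /eqP pk] /andP[_]; rewrite pk eqn_add2l eqn_modDl => /eqP.
by rewrite !modn_small.
Qed.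

Lemma exists_cyclic_edge k (i : nat) : ~~ odd n -> (i < m)%N ->
  exists2 p, cyclic_edge k p & nat_of_ord p.1 = i.
Proof.
move=> en im; have nE : (n = m + m)%N by rewrite addnn even_halfK.
have i_n : (i < n)%N by rewrite nE (leq_trans im)// leq_addr.
have j_n : (m + (i + k) %% m < n)%N.
  by rewrite [X in (_ < X)%N]nE ltn_add2l ltn_pmod// (leq_trans _ im).
by exists (Ordinal i_n, Ordinal j_n); rewrite /cyclic_edge /= ?im ?eqxx.
Qed.

Definition matching_max g k : R :=
  \big[Num.max/0]_(e in cyclic_matching n k) `|fourier g e|.

(** The default value [0] of the maximum is harmless: the matching is nonempty and absolute values
    are nonnegative. *)
Lemma matching_max_edge g k : ~~ odd n -> (0 < m)%N ->
  exists2 p, cyclic_edge k p & matching_max g k = `|fourier g [set p.1; p.2]%SET|.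
Proof.
move=> en m0; have [p0 p0k _] := exists_cyclic_edge k en m0.
have p0M : [set p0.1; p0.2]%SET \in cyclic_matching n k by apply/cyclic_matchingP; exists p0.
rewrite /matching_max.
have [|e eM ->] := @eq_bigmax _ _ _ 0 _ (fun e => e \in cyclic_matching n k)
  (fun e => `|fourier g e|) p0M; first by move=> *; exact: normr_ge0.
by have /cyclic_matchingP[p pk ->] := eM; exists p.
Qed.

Lemma matching_max_ge g k p : cyclic_edge k p ->
  `|fourier g [set p.1; p.2]%SET| <= matching_max g k.
Proof.
move=> pk; apply: (le_bigmax_cond 0 (fun e => `|fourier g e|)).
by apply/cyclic_matchingP; exists p.
Qed.

Lemma matching_max_ge0 g k : 0 <= matching_max g k.
Proof. by apply: bigmax_ge_id. Qed.

Lemma cyclic_valueE g : ~~ odd n ->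
  cyclic_value g = m%:R^-1 * \sum_(k < m) matching_max g k.
Proof.
move=> en; rewrite /cyclic_value; congr (_ * _).
rewrite -[X in _ / X%:R](even_halfK en) -muln2 natrM invfM mulrCA divff ?mulr1//.
Qed.

(** The edges of vertex [0] in the first two matchings share their left end; the triangle function
    on their three ends has a coefficient of at least 1 at both. *)
Lemma sum_matching_max_triangle : ~~ odd n -> (1 < m)%N ->
  exists2 g, feasible g & 2 <= \sum_(k < m) matching_max g k.
Proof.
move=> en m1; have m0 := ltnW m1.
have [p pk p1] := exists_cyclic_edge 0 en m0.
have [q qk q1] := exists_cyclic_edge 1 en m0.
have pq1 : p.1 = q.1 by apply/val_inj; rewrite /= p1.
have pq2 : p.2 != q.2.
  apply/eqP => pq2; have : p = q by case: p q pq1 pq2 {pk qk p1 q1} => ? ? [? ?] /= -> ->.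
  by move=> pq; have := cyclic_edge_inj m0 m1 pk; rewrite pq => /(_ qk).
have /andP[p1m p2m] := cyclic_edge_ltn pk; have /andP[q1m q2m] := cyclic_edge_ltn qk.
have u : uniq [:: p.1; p.2; q.2].
  rewrite /= !inE negb_or pq2 !andbT; apply/andP; split.
    by apply: contraNneq p2m => <-.
  by apply: contraNneq q2m => <-; rewrite pq1.
exists (triangle R p.1 p.2 q.2); first exact: triangle_feasible.
have [f1 f2] := triangle_fourier R p.1 p.2 q.2.
have := matching_max_ge (triangle R p.1 p.2 q.2) pk.
have := matching_max_ge (triangle R p.1 p.2 q.2) qk.
rewrite -pq1 !ger0_norm ?(le_trans ler01)// => M1 M0.
rewrite (bigD1 (Ordinal m0))//= (bigD1 (Ordinal m1))//=.
have rest : 0 <= \sum_(i < m | (i != Ordinal m0) && (i != Ordinal m1))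
    matching_max (triangle R p.1 p.2 q.2) i.
  by apply: sumr_ge0 => i _; exact: matching_max_ge0.
move: M0 M1 rest => /=; lra.
Qed.

End Cyclic.

Lemma Rcyc6 (R : realType) : is_Rcyc 6 (2 / 3 : R).
Proof.
have bound (g : cube 6 -> R) : feasible g -> \sum_(k < 3) matching_max g k <= 2.
  move=> gf; rewrite !big_ord_recr big_ord0 /= add0r.
  have [p0 e0 ->] := @matching_max_edge R 6 g 0 erefl erefl.
  have [p1 e1 ->] := @matching_max_edge R 6 g 1 erefl erefl.
  have [p2 e2 ->] := @matching_max_edge R 6 g 2 erefl erefl.
  (* Only three matchings exist here. A second edge of matching 0, at the next left vertex, is the
     fourth edge for [four_edges_le]; its nonnegative term is dropped at the end. *)
  have [p3 e3 p30] := @exists_cyclic_edge 6 0 ((p0.1).+1 %% 3) erefl (@ltn_pmod _ 3 isT).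
  have n03 : p0 != p3.
    apply/eqP => p03; move: p30; rewrite -p03.
    by case/andP: e0 => + _; case: (nat_of_ord p0.1) => [|[|[]]].
  have := @four_edges_le _ _ _ gf (fun i => (i < 3)%N) p0 p1 p2 p3.
  rewrite /= !(cyclic_edge_ltn e0, cyclic_edge_ltn e1, cyclic_edge_ltn e2, cyclic_edge_ltn e3).
  have ne k l (p q : 'I_6 * 'I_6) : (k < 3)%N -> (l < 3)%N -> k != l ->
      cyclic_edge k p -> cyclic_edge l q -> p != q.
    move=> k3 l3 kl pk ql; apply: contraNneq kl => pq; apply/eqP.
    by apply: (@cyclic_edge_inj 6 _ _ p) => //; rewrite pq.
  rewrite !inE !negb_or n03.
  rewrite (ne 0 1 p0 p1)%N// (ne 0 2 p0 p2)%N// (ne 1 2 p1 p2)%N//.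
  rewrite (ne 1 0 p1 p3)%N// (ne 2 0 p2 p3)%N// => /(_ isT isT).
  have := normr_ge0 (fourier g [set p3.1; p3.2]%SET); lra.
split.
  have [g gf g2] := @sum_matching_max_triangle R 6 erefl erefl.
  exists g => //; rewrite cyclic_valueE//.
  have -> : \sum_(k < 6./2) matching_max g k = 2 by apply: le_anti; rewrite g2 bound.
  by rewrite mulrC.
move=> _ [g gf <-]; rewrite cyclic_valueE// mulrC ler_pM2r ?invr_gt0 ?ltr0n//.
exact: bound.
Qed.

Lemma Rcyc8 (R : realType) : is_Rcyc 8 (1 / 2 : R).
Proof.
have bound (g : cube 8 -> R) : feasible g -> \sum_(k < 4) matching_max g k <= 2.
  move=> gf; rewrite !big_ord_recr big_ord0 /= add0r.
  have [p0 e0 ->] := @matching_max_edge R 8 g 0 erefl erefl.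
  have [p1 e1 ->] := @matching_max_edge R 8 g 1 erefl erefl.
  have [p2 e2 ->] := @matching_max_edge R 8 g 2 erefl erefl.
  have [p3 e3 ->] := @matching_max_edge R 8 g 3 erefl erefl.
  apply: (@four_edges_le _ _ _ gf (fun i => (i < 4)%N)).
    by rewrite /= !(cyclic_edge_ltn e0, cyclic_edge_ltn e1, cyclic_edge_ltn e2, cyclic_edge_ltn e3).
  have ne k l (p q : 'I_8 * 'I_8) : (k < 4)%N -> (l < 4)%N -> k != l ->
      cyclic_edge k p -> cyclic_edge l q -> p != q.
    move=> k3 l3 kl pk ql; apply: contraNneq kl => pq; apply/eqP.
    by apply: (@cyclic_edge_inj 8 _ _ p) => //; rewrite pq.
  rewrite /= !inE !negb_or.
  rewrite (ne 0 1 p0 p1)%N// (ne 0 2 p0 p2)%N// (ne 0 3 p0 p3)%N//.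
  by rewrite (ne 1 2 p1 p2)%N// (ne 1 3 p1 p3)%N// (ne 2 3 p2 p3)%N//.
split.
  have [g gf g2] := @sum_matching_max_triangle R 8 erefl erefl.
  exists g => //; rewrite cyclic_valueE//.
  have -> : \sum_(k < 8./2) matching_max g k = 2 by apply: le_anti; rewrite g2 bound.
  by rewrite /=; lra.
move=> _ [g gf <-]; rewrite cyclic_valueE//.
have : \sum_(k < 8./2) matching_max g k <= 2 := bound _ gf.
by rewrite /=; lra.
Qed.

(** * Noncontextual models *)

Lemma esum_finType (R : realType) (I : finType) (J : choiceType) (f : I -> J)
    (a : J -> R) : bijective f -> (forall j, 0 <= a j) ->
  (\esum_(j in [set: J]) (a j)%:E = (\sum_i a (f i))%:E)%E.
Proof.
move=> f_bij a0; rewrite (@reindex_esum _ I _ setT setT f); last by rewrite setTT_bijective.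
rewrite esum_fset; [|exact: finite_finset|by move=> i _; rewrite lee_fin].
have -> : [set: I]%classic = [set` enum I]%classic by apply/seteqP; split=> i //= _; rewrite mem_enum.
rewrite -fsbig_seq ?enum_uniq// big_enum /= sumEFin.
by congr (_%:E); exact: eq_bigl.
Qed.

(** * Finite mixtures of measures and their integrals *)

Section FiniteMixture.
Variables (d : measure_display) (T : measurableType d) (R : realType) (I : finType).
Variables (w : I -> R) (w_ge0 : forall i, 0 <= w i).
Variable mu : I -> {measure set T -> \bar R}.

(** [msum] sums a sequence of measures, so [I] is enumerated; the zero measure fills the indices
    from [#|I|] on. *)
Let term (k : nat) : {measure set T -> \bar R} :=
  if insub k is Some j then
    [the {measure set T -> \bar R} of
       mscale (NngNum (w_ge0 (@enum_val I predT j))) (mu (enum_val j))]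
  else [the {measure set T -> \bar R} of mzero].

Definition mixture : set T -> \bar R := msum term #|I|.

HB.instance Definition _ := Measure.on mixture.

Lemma mixtureE A : mixture A = (\sum_i (w i)%:E * mu i A)%E.
Proof.
transitivity (\sum_(i in I) (w i)%:E * mu i A)%E; last exact: eq_bigl.
rewrite [RHS]big_enum_val; apply: eq_bigr => j _.
by rewrite /term valK.
Qed.

Lemma integral_mixture (f : T -> \bar R) : (forall x, 0 <= f x)%E ->
  measurable_fun setT f ->
  (\int[mixture]_x f x = \sum_i (w i)%:E * \int[mu i]_x f x)%E.
Proof.
move=> f0 mf; transitivity (\sum_(i in I) (w i)%:E * \int[mu i]_x f x)%E; last exact: eq_bigl.
rewrite ge0_integral_measure_sum// [RHS]big_enum_val; apply: eq_bigr => j _.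
by rewrite /term valK ge0_integral_mscale.
Qed.

End FiniteMixture.

Section UnitIntervalFunctions.
Variables (d : measure_display) (T : measurableType d) (R : realType).
Implicit Type (P : probability T R).

Definition unit_measurable (f : T -> R) :=
  measurable_fun setT f /\ forall x, 0 <= f x <= 1.

Lemma unit_measurable_integrable P f : unit_measurable f ->
  P.-integrable setT (EFin \o f).
Proof.
move=> [mf f01]; apply: measurable_bounded_integrable => //.
  by apply: le_lt_trans (probability_le1 P measurableT) _; rewrite ltry.
exists 1; split; first exact: num_real.
move=> M M1 x _ /=; have /andP[f0 f1] := f01 x.
by rewrite ger0_norm// (le_trans f1)// ltW.
Qed.

Lemma Rintegral_fin P f : unit_measurable f ->
  (\int[P]_x (f x)%:E)%E = (\int[P]_x f x)%:E.
Proof.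
move=> uf; rewrite /Rintegral fineK//.
by apply: integrable_fin_num => //; exact: unit_measurable_integrable.
Qed.

Lemma Rintegral_sum P (J : finType) (c : J -> R) (f : J -> T -> R) :
  (forall j, unit_measurable (f j)) ->
  \int[P]_x (\sum_j c j * f j x) = \sum_j c j * \int[P]_x f j x.
Proof.
move=> uf; rewrite {1}/Rintegral.
under eq_integral do rewrite -sumEFin.
rewrite integral_sum//; last first.
  move=> j; have := integrableZl measurableT (c j) (unit_measurable_integrable P (uf j)).
  by apply: eq_integrable.
under eq_bigr => j _.
  under eq_integral do rewrite EFinM.
  rewrite integralZl//; last exact: unit_measurable_integrable.
  rewrite Rintegral_fin// -EFinM.
  over.
by rewrite sumEFin.
Qed.

Lemma unit_measurable_prod (J : finType) (f : J -> T -> R) :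
  (forall j, unit_measurable (f j)) -> unit_measurable (fun x => \prod_j f j x).
Proof.
move=> uf; split; first by apply: measurable_prod => j _; case: (uf j).
move=> x; rewrite prodr_ge0 => [|j _]; last by case: (uf j) => _ /(_ x) /andP[].
by apply: prodr_ile1 => j _; case: (uf j) => _ /(_ x).
Qed.

End UnitIntervalFunctions.

Lemma parity_indicator (R : realType) (n : nat) (b : bool) (S : {set 'I_n}) (x : cube n) :
  (b == parity S x)%:R = (1 + (-1) ^+ b * set_chi R S x) / 2 :> R.
Proof.
by rewrite set_chi_parity; case: b; case: (parity S x);
  rewrite /= ?expr1 ?expr0 ?(mulr1, mul1r, mulrN, mulNr); lra.
Qed.

(** Here [N x] stands for the weight of the strategy [sigma] on input [x]. Divided by its mean [M]
    it is feasible, and its score on the [k]-th matching is [(M + s c) / 2] with [c] the coefficient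
    of [N] at the answered edge and [s] the answered sign. *)
Lemma strategy_success_le (R : realType) (n : nat) (v : R) (N : cube n -> R)
    (sigma : 'I_n./2 -> {set 'I_n} * bool) :
  ~~ odd n -> (0 < n./2)%N ->
  (forall g : cube n -> R, feasible g -> cyclic_value g <= v) ->
  (forall x, 0 <= N x) ->
  (forall S, S \in oblivious_family n -> \sum_x N x * set_chi R S x = 0) ->
  (forall k, (sigma k).1 \in cyclic_matching n k) ->
  (2 ^+ n)^-1 * \sum_x (n./2)%:R^-1 * \sum_(k < n./2)
      ((sigma k).2 == parity (sigma k).1 x)%:R * N x
    <= (1 + v) / 2 * ((2 ^+ n)^-1 * \sum_x N x).
Proof.
move=> en m0 vP N0 NF sigmaM; set M := _ * \sum_x N x.
have m0R : 0 < (n./2)%:R :> R by rewrite ltr0n.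
have c0 : 0 < (2 ^+ n)^-1 :> R by rewrite invr_gt0 exprn_gt0.
have M0 : 0 <= M by apply: mulr_ge0 (ltW c0) _; exact: sumr_ge0.
have -> : (2 ^+ n)^-1 * \sum_x (n./2)%:R^-1 * \sum_(k < n./2)
      ((sigma k).2 == parity (sigma k).1 x)%:R * N x
    = (n./2)%:R^-1 * \sum_(k < n./2) (M + (-1) ^+ (sigma k).2 * fourier N (sigma k).1) / 2.
  rewrite -mulr_sumr exchange_big /= mulrCA mulr_sumr; congr (_ * _); apply: eq_bigr => k _.
  rewrite /M /fourier mulrCA -mulrDr -mulrA; congr (_ * _).
  rewrite mulr_sumr -big_split /= mulr_suml; apply: eq_bigr => x _.
  by rewrite parity_indicator /set_chi; ring.
(* If the mean is zero, [N] vanishes identically and cannot be normalised, but both sides are then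
   zero. *)
have [Mz|Mn] := eqVneq M 0.
  have Nz x : N x = 0.
    apply/eqP; have /eqP : \sum_x N x = 0.
      by apply/eqP; move/eqP: Mz; rewrite mulf_eq0 (gt_eqF c0).
    by rewrite psumr_eq0// => /allP/(_ x); rewrite mem_index_enum => /(_ isT).
  have Fz S : fourier N S = 0.
    by rewrite /fourier big1 ?mulr0// => x _; rewrite Nz mul0r.
  by rewrite Mz mulr0 big1 ?mulr0// => k _; rewrite Fz mulr0 addr0 mul0r.
have {Mn}M_gt0 : 0 < M by rewrite lt_def Mn.
pose g x := N x / M.
have gF S : fourier g S = fourier N S / M.
  rewrite /fourier /g -mulrA mulr_suml; congr (_ * _); apply: eq_bigr => x _.
  by rewrite mulrAC.
have gf : feasible g.
  split=> [x||S SF]; first by rewrite /g divr_ge0.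
    rewrite gF /fourier; under eq_bigr do rewrite big_set0 mulr1.
    by rewrite divff// gt_eqF.
  by have := NF _ SF; rewrite gF /fourier /set_chi => ->; rewrite mulr0 mul0r.
have := vP g gf; rewrite cyclic_valueE// => vg.
apply: (@le_trans _ _ ((n./2)%:R^-1 * \sum_(k < n./2) (M / 2 * (1 + matching_max g k)))).
  rewrite ler_pM2l ?invr_gt0//; apply: ler_sum => k _.
  have : (-1) ^+ (sigma k).2 * fourier N (sigma k).1 <= M * matching_max g k.
    have -> : fourier N (sigma k).1 = M * fourier g (sigma k).1.
      by rewrite gF mulrC divfK// gt_eqF.
    rewrite mulrCA ler_pM2l//.
    apply: (@le_trans _ _ `|fourier g (sigma k).1|).
      by apply: le_trans (ler_norm _) _; rewrite normrMsign.
    exact: (le_bigmax_cond 0 (fun e => `|fourier g e|)).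
  by lra.
rewrite -mulr_sumr big_split /= sumr_const card_ord mulrCA mulrDr.
have -> : (n./2)%:R^-1 * (1 *+ n./2) = 1 :> R by rewrite mulVf ?gt_eqF.
by rewrite mulrC [leRHS]mulrC mulrA; have := ler_wpM2l M0 vg; lra.
Qed.

Lemma sum_insub (R : nmodType) (T U : finType) (P : pred T) (h : {x | P x} * U -> R) :
  \sum_(o : T * U) (if insub o.1 is Some e then h (e, o.2) else 0) = \sum_o h o.
Proof.
rewrite -(pair_bigA _ (fun a b => if insub a is Some e then h (e, b) else 0)) /=.
rewrite [RHS](eq_bigr (fun o => h (o.1, o.2))); last by case.
rewrite -(pair_bigA _ (fun a b => h (a, b))) /=.
rewrite (bigID P) /= [X in _ + X]big1 ?addr0; last first.
  by move=> a Pa; rewrite big1// => b _; rewrite insubN.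
rewrite (big_sub P); apply: eq_bigr => e _; apply: eq_bigr => b _.
by rewrite valK.
Qed.

Section ParityWeight.
Variables (R : realType) (n : nat) (S : {set 'I_n}).
Hypothesis S_neq0 : S != finset.set0.

Let w b := uniform_weight R [set x : cube n | parity S x == b]%SET.

(** The character of a nonempty set sums to zero, so both parities are equally frequent. *)
Lemma parity_count (b : bool) :
  #|[set x : cube n | parity S x == b]%SET|%:R = 2 ^+ n / 2 :> R.
Proof.
rewrite -sum1_card natr_sum big_mkcond /=.
rewrite (eq_bigr (fun x => (1 + (-1) ^+ b * set_chi R S x) / 2)); last first.
  by move=> x _; rewrite inE eq_sym -parity_indicator; case: (b == _).
rewrite -mulr_suml big_split /= -mulr_sumr sum_set_chi (negPf S_neq0) !mulr0 addr0.
by rewrite sumr_const card_ffun card_bool card_ord -natrX.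
Qed.

Lemma parity_weightE b x : w b x = (b == parity S x)%:R / (2 ^+ n / 2).
Proof. by rewrite /w /uniform_weight parity_count inE eq_sym. Qed.

Lemma parity_weight_ge0 b x : 0 <= w b x.
Proof.
by rewrite parity_weightE !mulr_ge0// ?invr_ge0 ?mulr_ge0// ?exprn_ge0// invr_ge0.
Qed.

Lemma parity_weight_is_weight b : is_weight (w b).
Proof.
split=> [x|]; first exact: parity_weight_ge0.
rewrite /w /uniform_weight -mulr_suml parity_count.
suff -> : \sum_x (x \in [set x : cube n | parity S x == b]%SET)%:R = 2 ^+ n / 2 :> R.
  by rewrite divff// mulf_neq0 ?expf_neq0// ?pnatr_eq0// invr_eq0 pnatr_eq0.
rewrite -(parity_count b) -sum1_card natr_sum [RHS]big_mkcond.
by apply: eq_bigr => x _; case: ifP.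
Qed.

(** The indicators of the two parities differ by the character of [S]; this turns obliviousness into
    the vanishing of a Fourier coefficient. *)
Lemma parity_weight_diff (F : cube n -> R) :
  \sum_x w false x * F x - \sum_x w true x * F x
    = (\sum_x F x * set_chi R S x) / (2 ^+ n / 2).
Proof.
rewrite -sumrB mulr_suml; apply: eq_bigr => x _.
rewrite !parity_weightE !parity_indicator /= expr0 expr1.
by set D := (_ / _)^-1; lra.
Qed.

End ParityWeight.

(** * Upper bound on the success probability *)

Section UpperBound.
Variables (R : realType) (n : nat) (T : operational_theory R) (Q : protocol n T).
Variable O : ontological_model T.
Hypotheses (O_noncontextual : preparation_noncontextual O) (Q_oblivious : parity_oblivious Q).

Let mu x := state O (encode Q x).

(** Noncontextuality gives the two parity preparations the same measure, hence the same integral of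
    [f]; by [state_mix] these integrals are the two parity averages of the integrals against
    [mu x]. *)
Lemma oblivious_moment (f : ontic O -> R) (S : {set 'I_n}) :
  unit_measurable f -> S \in oblivious_family n ->
  \sum_x (\int[mu x]_l f l) * set_chi R S x = 0.
Proof.
move=> uf SF; have [mf f01] := uf.
have S0 : S != finset.set0 by move: SF; rewrite inE -cards_eq0 => /andP[].
pose w b := uniform_weight R [set x : cube n | parity S x == b]%SET.
have w0 b x : 0 <= w b x by exact: parity_weight_ge0.
have E b : (\int[state O (parity_prep Q S b)]_l (f l)%:E)%E =
    (\sum_x w b x * \int[mu x]_l f l)%:E.
  transitivity (\int[mixture (w0 b) mu]_l (f l)%:E)%E.
    apply: eq_measure_integral => A mA _.
    by apply: etrans (esym (mixtureE (w0 b) mu A)); exact: (state_mix (encode Q) (parity_weight_is_weight R S0 b) mA).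
  rewrite integral_mixture.
  - rewrite -sumEFin; apply: eq_bigr => x _; rewrite [RHS]EFinM.
    by rewrite -(Rintegral_fin (mu x) uf).
  - by move=> l; rewrite lee_fin; case/andP: (f01 l).
  - exact/measurable_EFinP.
have : (\sum_x w false x * \int[mu x]_l f l)%:E = (\sum_x w true x * \int[mu x]_l f l)%:E.
  rewrite -!E; apply: eq_measure_integral => A mA _.
  by apply: O_noncontextual => //; exact: Q_oblivious.
move=> [] /eqP; rewrite -subr_eq0 parity_weight_diff// mulf_eq0 => /orP[/eqP//|].
by rewrite invr_eq0 mulf_eq0 invr_eq0 expf_eq0 !pnatr_eq0 andbF.
Qed.

(** Responses are extended by zero to all pairs of a set and a bit, so that every matching has the
    same answer type and strategies form one finite function type. *)
Let eta (k : 'I_n./2) (o : {set 'I_n} * bool) (l : ontic O) : R :=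
  if insub o.1 is Some e then response (@label R n T Q k (e, o.2)) l else 0.

Lemma unit_measurable_response (M : meas T) (k : outcome M) :
  unit_measurable (@response R T O M k).
Proof. by split; [exact: response_measurable | move=> l; exact: response_ge0_le1]. Qed.

Lemma unit_measurable_eta k o : unit_measurable (eta k o).
Proof.
rewrite /eta; case: insubP => [e _ _|_]; first exact: unit_measurable_response.
by split => [|l]; [exact: measurable_cst | rewrite lexx ler01].
Qed.

Lemma sum_eta k l : \sum_o eta k o l = 1.
Proof.
rewrite /eta (sum_insub (fun o => response (@label R n T Q k o) l)).
apply: EFin_inj; rewrite -(response_sum1 (query Q k) l).
by rewrite (esum_finType (@label_bij R n T Q k))// => o; case/andP: (response_ge0_le1 o l).
Qed.

Let strategy := {ffun 'I_n./2 -> {set 'I_n} * bool}.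

(* The weight of the deterministic strategy that answers [sigma k] to the
   [k]-th matching when these answers are drawn independently given [l]. *)
Let q (sigma : strategy) (l : ontic O) : R :=
  \prod_k eta k (sigma k) l.

(** This is marginalisation: when the product of sums is expanded, each factor other than the [k]-th
    is a total probability, equal to 1. *)
Lemma sum_strategies k (h : {set 'I_n} * bool -> R) l :
  \sum_(sigma : strategy) h (sigma k) * q sigma l = \sum_o h o * eta k o l.
Proof.
pose F j o := (if j == k then h o else 1) * eta j o l.
transitivity (\prod_j \sum_o F j o).
  rewrite bigA_distr_bigA; apply: eq_bigr => sigma _.
  rewrite /F big_split /= -/(q sigma l) (bigD1 k)//= eqxx big1 ?mulr1// => j /negPf ->.
  by [].
rewrite (bigD1 k)//= {1}/F eqxx [X in _ * X]big1 ?mulr1// => j jk.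
rewrite /F (negPf jk) -[RHS](sum_eta j l); apply: eq_bigr => o _; exact: mul1r.
Qed.

Lemma success_le (v : R) : ~~ odd n -> (0 < n./2)%N ->
  (forall g : cube n -> R, feasible g -> cyclic_value g <= v) ->
  success Q <= (1 + v) / 2.
Proof.
move=> en m0 vP.
have uq sigma : unit_measurable (q sigma).
  by apply: unit_measurable_prod => k; exact: unit_measurable_eta.
(* [nu sigma x] is the probability that the strategy [sigma] is followed on input [x]. *)
pose nu sigma x := \int[mu x]_l q sigma l.
have nu_sum k h x : \sum_(sigma : strategy) h (sigma k) * nu sigma x = \int[mu x]_l (\sum_o h o * eta k o l).
  rewrite -Rintegral_sum//; apply: eq_Rintegral => l _.
  by rewrite sum_strategies.
have nu1 x : \sum_(sigma : strategy) nu sigma x = 1.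
  (* The total mass is the marginal of the constant payoff [1] at matching 0. *)
  transitivity (\sum_(sigma : strategy) (fun=> 1) (sigma (Ordinal m0)) * nu sigma x).
    by apply: eq_bigr => sigma _; rewrite mul1r.
  rewrite (nu_sum (Ordinal m0) (fun=> 1)).
  under eq_Rintegral do (under eq_bigr do rewrite mul1r; rewrite sum_eta).
  by rewrite Rintegral_cst// mul1r; rewrite -[RHS]/(fine 1%E); congr fine; exact: probability_setT.
have -> : success Q = \sum_(sigma : strategy) (2 ^+ n)^-1 * \sum_x (n./2)%:R^-1 * \sum_(k < n./2)
      ((sigma k).2 == parity (sigma k).1 x)%:R * nu sigma x.
  rewrite /success -[RHS]mulr_sumr; congr (_ * _); rewrite [RHS]exchange_big; apply: eq_bigr => x _.
  rewrite -[RHS]mulr_sumr; congr (_ * _); rewrite [RHS]exchange_big; apply: eq_bigr => k _ /=.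
  rewrite (nu_sum k (fun o => (o.2 == parity o.1 x)%:R)).
  transitivity (\int[mu x]_l \sum_(o : {e | e \in cyclic_matching n k} * bool)
    (o.2 == parity (val o.1) x)%:R * response (@label R n T Q k o) l).
    rewrite Rintegral_sum; last by move=> o; exact: unit_measurable_response.
    rewrite big_mkcond; apply: eq_bigr => o _.
    case: ifP => _; last by rewrite mul0r.
    rewrite mul1r; apply: EFin_inj; rewrite (response_prob O) Rintegral_fin//.
    exact: unit_measurable_response.
  apply: eq_Rintegral => l _.
  rewrite -(sum_insub (fun o : {e | e \in cyclic_matching n k} * bool =>
    (o.2 == parity (val o.1) x)%:R * response (@label R n T Q k o) l)).
  apply: eq_bigr => -[e b] _; rewrite /eta /=.
  by case: insubP => [e' _ <-|_] //; rewrite mulr0.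
apply: (@le_trans _ _ (\sum_(sigma : strategy) (1 + v) / 2 * ((2 ^+ n)^-1 * \sum_x nu sigma x))).
  apply: ler_sum => sigma _.
  have [/forallP sM|] := boolP [forall k, (sigma k).1 \in cyclic_matching n k].
    apply: strategy_success_le => //.
      by move=> x; apply: Rintegral_ge0 => l _; case: (uq sigma) => _ /(_ l) /andP[].
    by move=> S SF; exact: oblivious_moment.
  (* A strategy that answers outside some matching has weight zero, because [eta] vanishes there. *)
  rewrite negb_forall => /existsP[k kM].
  have nu0 x : nu sigma x = 0.
    rewrite /nu (_ : q sigma = fun=> 0) ?Rintegral_cst ?mul0r//.
    apply/funext => l; rewrite /q (bigD1 k)//= /eta insubN// mul0r //.
  rewrite big1 ?mulr0; last by move=> x _; rewrite big1 ?mulr0// => j _; rewrite nu0 mulr0.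
  by rewrite big1 ?mulr0// => x _; rewrite nu0.
rewrite -mulr_sumr -mulr_sumr exchange_big /=.
under eq_bigr do rewrite nu1.
rewrite sumr_const card_ffun card_bool card_ord natrX mulVf ?mulr1//.
Qed.

End UpperBound.

(** * A classical two-bit theory *)

(** A type of its own, to carry the discrete sigma-algebra. *)
Definition two_bits : Type := (bool * bool)%type.

HB.instance Definition _ := Finite.on two_bits.
HB.instance Definition _ := Pointed.on two_bits.
HB.instance Definition _ := @isMeasurable.Build default_measure_display two_bits
  discrete_measurable discrete_measurable0 discrete_measurableC discrete_measurableU.

Section TwoBitTheory.
Variables (R : realType) (n : nat).
Local Notation m := (n./2).
Variable p : 'I_m -> 'I_n * 'I_n.
Hypothesis p_cyclic : forall k : 'I_m, cyclic_edge k (p k).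
Hypotheses (m_gt1 : (1 < m)%N) (p_left : forall k l, (p k).1 = (p l).1).

Definition law : Type := {w : two_bits -> R | is_weight w}.

Lemma point_is_weight (l : two_bits) : is_weight (fun i => (i == l)%:R : R).
Proof.
split=> // ; rewrite (bigD1 l)//= eqxx big1 ?addr0// => i /negPf ->.
by [].
Qed.

Definition point l : law := exist _ _ (point_is_weight l).

Lemma mix_is_weight (I : finType) (w : I -> R) (P : I -> law) : is_weight w ->
  is_weight (fun l => \sum_i w i * sval (P i) l).
Proof.
move=> [w0 w1]; split=> [l|].
  by apply: sumr_ge0 => i _; apply: mulr_ge0 => //; case: (svalP (P i)).
rewrite exchange_big -[RHS]w1; apply: eq_bigr => i _ /=.
by rewrite -mulr_sumr; case: (svalP (P i)) => _ ->; rewrite mulr1.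
Qed.

(** A mixture needs a value for all [w]; a point law is the default when [w] is not a probability
    vector. *)
Definition mix_law (I : finType) (w : I -> R) (P : I -> law) : law :=
  if pselect (is_weight w) is left ww then exist _ _ (mix_is_weight P ww)
  else point (false, false).

Lemma mix_lawE (I : finType) (w : I -> R) (P : I -> law) l : is_weight w ->
  sval (mix_law w P) l = \sum_i w i * sval (P i) l.
Proof. by rewrite /mix_law; case: pselect. Qed.

(** The measurement [None] reads out both bits. It separates any two laws, which is what makes the
    model noncontextual. *)
Definition answers (M : option 'I_m) : finType :=
  if M is Some k then
    ({e : {set 'I_n} | e \in cyclic_matching n k} * bool)%type : finType
  else two_bits.

Lemma p_matching k : [set (p k).1; (p k).2]%SET \in cyclic_matching n k.
Proof. by apply/cyclic_matchingP; exists (p k). Qed.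

(** Matchings 0 and 1 are answered by the first and the second bit, all others by the constant guess
    [false]. *)
Definition answer (M : option 'I_m) : two_bits -> answers M :=
  if M is Some k return two_bits -> answers M then
    fun l => (exist (fun e : {set 'I_n} => e \in cyclic_matching n k) _ (p_matching k),
              if k == 0%N :> nat then l.1 else if k == 1%N :> nat then l.2 else false)
  else id.

Definition answer_prob (M : option 'I_m) (k : answers M) (P : law) : R :=
  \sum_l sval P l * (answer M l == k)%:R.

Lemma answer_prob_ge0 (M : option 'I_m) (k : answers M) (P : law) : 0 <= answer_prob k P.
Proof. by apply: sumr_ge0 => l _; apply: mulr_ge0 => //; case: (svalP P). Qed.

Lemma sum_answer (M : option 'I_m) l : \sum_k (answer M l == k)%:R = 1 :> R.
Proof.
rewrite (bigD1 (answer M l))//= eqxx big1 ?addr0// => k.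
by rewrite eq_sym => /negPf ->.
Qed.

Lemma answer_prob_sum1 (M : option 'I_m) (P : law) :
  (\esum_(k in [set: answers M]) (answer_prob k P)%:E = 1)%E.
Proof.
rewrite (@esum_finType _ (answers M) _ id); [|by exists id|by move=> k; exact: answer_prob_ge0].
congr (_%:E); rewrite exchange_big /=; case: (svalP P) => _ P1; rewrite -[RHS]P1.
by apply: eq_bigr => l _; rewrite -mulr_sumr sum_answer mulr1.
Qed.

Lemma answer_prob_mix (I : finType) (w : I -> R) (P : I -> law) : is_weight w ->
  forall (M : option 'I_m) (k : answers M),
    answer_prob k (mix_law w P) = \sum_i w i * answer_prob k (P i).
Proof.
move=> ww M k; rewrite /answer_prob.
under eq_bigr do rewrite mix_lawE// mulr_suml.
rewrite exchange_big; apply: eq_bigr => i _ /=.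
by rewrite mulr_sumr; apply: eq_bigr => l _; rewrite mulrA.
Qed.

Definition two_bit_theory : operational_theory R :=
  @OperationalTheory R law (option 'I_m) (fun M => answers M : countType)
    answer_prob mix_law answer_prob_ge0 answer_prob_sum1 answer_prob_mix.

Lemma law_ge0 (P : law) l : 0 <= sval P l.
Proof. by case: (svalP P). Qed.

Definition law_measure (P : law) : set two_bits -> \bar R :=
  mixture (law_ge0 P) (fun l => [the {measure set two_bits -> \bar R} of \d_l]).

HB.instance Definition _ (P : law) := Measure.on (law_measure P).

Lemma law_measureE (P : law) A :
  law_measure P A = (\sum_l sval P l * (l \in A)%:R)%:E.
Proof.
rewrite /law_measure mixtureE -sumEFin; apply: eq_bigr => l _.
by rewrite [RHS]EFinM; congr (_ * _)%E; exact: diracE.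
Qed.

Lemma law_measure_setT (P : law) : law_measure P setT = 1%E.
Proof.
rewrite law_measureE; case: (svalP P) => _ P1; rewrite -[in RHS]P1.
by congr (_%:E); apply: eq_bigr => l _; rewrite in_setT mulr1.
Qed.

HB.instance Definition _ (P : law) :=
  Measure_isProbability.Build _ _ _ (law_measure P) (law_measure_setT P).

Definition two_bit_response (M : option 'I_m) (k : answers M) (l : two_bits) : R :=
  (answer M l == k)%:R.

Lemma law_measure_mix (I : finType) (w : I -> R) (P : I -> law) : is_weight w ->
  forall A : set two_bits, measurable A ->
    (law_measure (mix_law w P) A = \sum_i (w i)%:E * law_measure (P i) A)%E.
Proof.
move=> ww A _; rewrite law_measureE.
under [RHS]eq_bigr do rewrite law_measureE -EFinM.
rewrite sumEFin; congr (_%:E).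
under eq_bigr do rewrite mix_lawE// mulr_suml.
rewrite exchange_big; apply: eq_bigr => i _ /=.
by rewrite mulr_sumr; apply: eq_bigr => l _; rewrite mulrA.
Qed.

Lemma two_bit_response_measurable (M : option 'I_m) (k : answers M) :
  measurable_fun setT (two_bit_response k).
Proof. by move=> _ B _. Qed.

Lemma two_bit_response_ge0_le1 (M : option 'I_m) (k : answers M) l :
  0 <= two_bit_response k l <= 1.
Proof. by rewrite /two_bit_response; case: eqP => _; rewrite lexx ler01. Qed.

Lemma two_bit_response_sum1 (M : option 'I_m) l :
  (\esum_(k in [set: answers M]) (two_bit_response k l)%:E = 1)%E.
Proof.
rewrite (@esum_finType _ (answers M) _ id); [|by exists id|].
  by rewrite sum_answer.
by move=> k; case/andP: (two_bit_response_ge0_le1 k l).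
Qed.

Lemma two_bit_response_prob (M : option 'I_m) (k : answers M) (P : law) :
  ((answer_prob k P)%:E = \int[law_measure P]_l (two_bit_response k l)%:E)%E.
Proof.
rewrite integral_mixture.
- rewrite -sumEFin; apply: eq_bigr => l _; rewrite [LHS]EFinM integral_dirac//.
  by rewrite diracE in_setT mul1e.
- by move=> l; rewrite lee_fin; case/andP: (two_bit_response_ge0_le1 k l).
- by move=> _ B _.
Qed.

Definition two_bit_model : ontological_model two_bit_theory :=
  @OntologicalModel R two_bit_theory default_measure_display two_bits
    (fun P => [the probability two_bits R of law_measure P]) two_bit_response
    law_measure_mix two_bit_response_measurable two_bit_response_ge0_le1
    two_bit_response_sum1 two_bit_response_prob.

Lemma two_bit_model_noncontextual : preparation_noncontextual two_bit_model.
Proof.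
move=> P P' PP' A _; rewrite [LHS]law_measureE [RHS]law_measureE.
congr (_%:E); apply: eq_bigr => l _; congr (_ * _).
have val_prob (P0 : law) : @answer_prob None l P0 = sval P0 l.
  rewrite /answer_prob (bigD1 l)//= eqxx mulr1 big1 ?addr0// => i /negPf il.
  by rewrite il mulr0.
by rewrite -!val_prob; exact: (PP' None l).
Qed.

Let k0 : 'I_m := Ordinal (ltnW m_gt1).
Let k1 : 'I_m := Ordinal m_gt1.
Let edge k : {set 'I_n} := [set (p k).1; (p k).2]%SET.

Definition known_bits (x : cube n) : two_bits := (parity (edge k0) x, parity (edge k1) x).

Definition two_bit_protocol : protocol n two_bit_theory :=
  @Protocol R n two_bit_theory (fun x => point (known_bits x)) Some
    (fun k => @id ({e : {set 'I_n} | e \in cyclic_matching n k} * bool)%type)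
    (fun k => @Bijective _ _ id id (fun _ => erefl) (fun _ => erefl)).

Lemma point_prob (M : option 'I_m) (k : answers M) l :
  answer_prob k (point l) = (answer M l == k)%:R.
Proof.
rewrite /answer_prob (bigD1 l)//= eqxx mul1r big1 ?addr0// => i /negPf ->.
by rewrite mul0r.
Qed.

Lemma right_neq : (p k0).2 != (p k1).2.
Proof.
apply/eqP => E2; have E : p k0 = p k1.
  by have := p_left k0 k1; case: (p k0) (p k1) E2 => ? ? [? ?] /= -> ->.
have := p_cyclic k1; rewrite -E => e1.
by have := cyclic_edge_inj (ltn_ord k0) (ltn_ord k1) (p_cyclic k0) e1.
Qed.

Lemma left_neq_right k : (p k).1 != (p k).2.
Proof.
have /andP[l r] := cyclic_edge_ltn (p_cyclic k).
by apply: contraNneq r => <-.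
Qed.

Lemma card_edge k : #|edge k| = 2.
Proof. by rewrite cards2 left_neq_right. Qed.

(** The sign of the common left vertex cancels, so products of the two revealed characters stay
    within sets of size 0 and 2. *)
Lemma set_chi_edges x :
  set_chi R (edge k0) x * set_chi R (edge k1) x
    = set_chi R [set (p k0).2; (p k1).2]%SET x.
Proof.
rewrite /set_chi !(big_setU1, big_set1) ?inE ?left_neq_right ?right_neq//=.
rewrite (p_left k1 k0); set s := _ ^+ x (p k0).1.
have ss : s * s = 1 by rewrite -signr_addb addbb.
by rewrite mulrACA ss mul1r.
Qed.

Lemma sum_known_bits (S : {set 'I_n}) (h : two_bits -> R) : S \in oblivious_family n ->
  \sum_x h (known_bits x) * set_chi R S x = 0.
Proof.
rewrite inE => /andP[S0 S2].
(* The factor after [h l] is, with its [1 / 4], the indicator of [known_bits x = l]; it expands into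
   characters of the empty set and of three pairs, none in the oblivious family. *)
have hE x : h (known_bits x) = \sum_(l : two_bits)
    h l / 4 * (1 + (-1) ^+ l.1 * set_chi R (edge k0) x + (-1) ^+ l.2 * set_chi R (edge k1) x
      + (-1) ^+ l.1 * (-1) ^+ l.2 * set_chi R [set (p k0).2; (p k1).2]%SET x).
  rewrite (bigD1 (known_bits x))//= big1 ?addr0 => [|l ne].
    rewrite -set_chi_edges !set_chi_parity /known_bits.
    by case: (parity (edge k0) x); case: (parity (edge k1) x);
      rewrite /= ?expr0 ?expr1 ?(mulr1, mul1r, mulrN, mulNr); lra.
  rewrite -set_chi_edges !set_chi_parity; move: ne; rewrite /known_bits.
  by case: l => [[] []]; case: (parity (edge k0) x); case: (parity (edge k1) x) => //= _;
    rewrite ?expr0 ?expr1 ?(mulr1, mul1r, mulrN, mulNr); lra.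
have chi0 (U : {set 'I_n}) : U != S -> \sum_x set_chi R U x * set_chi R S x = 0.
  by move=> US; rewrite set_chi_orthogonal (negPf US) mulr0.
have S2' (U : {set 'I_n}) : #|U| = 2 -> U != S by move=> U2; apply: contraNneq S2 => <-; rewrite U2.
under eq_bigr do rewrite hE mulr_suml.
rewrite exchange_big big1// => l _ /=.
transitivity (h l / 4 * (\sum_x set_chi R S x + (-1) ^+ l.1 * \sum_x set_chi R (edge k0) x * set_chi R S x
   + (-1) ^+ l.2 * \sum_x set_chi R (edge k1) x * set_chi R S x
   + (-1) ^+ l.1 * (-1) ^+ l.2 * \sum_x set_chi R [set (p k0).2; (p k1).2]%SET x * set_chi R S x)).
  rewrite !mulr_sumr -!big_split mulr_sumr; apply: eq_bigr => x _ /=; ring.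
rewrite sum_set_chi -cards_eq0 (negPf S0) !chi0 ?S2' ?card_edge ?cards2 ?right_neq//.
by rewrite !mulr0 !addr0 mulr0.
Qed.

Lemma two_bit_oblivious : parity_oblivious two_bit_protocol.
Proof.
move=> S SF M k; have S0 : S != finset.set0.
  by move: SF; rewrite inE -cards_eq0 => /andP[].
rewrite /parity_prep [LHS]answer_prob_mix; last exact: parity_weight_is_weight.
rewrite [RHS]answer_prob_mix; last exact: parity_weight_is_weight.
apply/eqP; rewrite -subr_eq0 (parity_weight_diff S0) /=.
under eq_bigr do rewrite point_prob.
by rewrite (@sum_known_bits S (fun l => (answer M l == k)%:R))// mul0r.
Qed.

(** The first two matchings are always answered correctly; on each other one the fixed guess is
    right for half of the inputs, as the parity of an edge is balanced. *)
Lemma two_bit_success : success two_bit_protocol = (1 + 2 / m%:R) / 2.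
Proof.
have m0 : m%:R != 0 :> R by rewrite pnatr_eq0 -lt0n ltnW.
have inner x (k : 'I_m) : \sum_(o : {e : {set 'I_n} | e \in cyclic_matching n k} * bool
      | o.2 == parity (val o.1) x) answer_prob (o : answers (Some k)) (point (known_bits x))
    = ((answer (Some k) (known_bits x)).2 == parity (edge k) x)%:R.
  under eq_bigr do rewrite point_prob.
  rewrite big_mkcond (bigD1 (answer (Some k) (known_bits x)))//= eqxx big1 ?addr0.
    by case: ifP.
  move=> o; rewrite eq_sym => /negPf one; case: ifP => // _.
  exact: (congr1 (fun b : bool => b%:R : R) one).
rewrite /success.
transitivity (m%:R^-1 * \sum_(k < m) ((1 + (k == k0)%:R + (k == k1)%:R) / 2 : R)).
  transitivity ((2 ^+ n)^-1 * \sum_(x : cube n) m%:R^-1 * \sum_(k < m)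
      ((answer (Some k) (known_bits x)).2 == parity (edge k) x)%:R : R).
    congr (_ * _); apply: eq_bigr => x _; congr (_ * _); apply: eq_bigr => k _.
    exact: inner.
  rewrite -mulr_sumr mulrCA exchange_big mulr_sumr; congr (_ * _); apply: eq_bigr => k _ /=.
  have [->|kk0] := eqVneq k k0.
    under eq_bigr do rewrite /= eqxx.
    rewrite sumr_const card_ffun card_bool card_ord natrX mulVf ?expf_neq0 ?pnatr_eq0//=.
    lra.
  have [->|kk1] := eqVneq k k1.
    under eq_bigr do rewrite /= eqxx.
    rewrite sumr_const card_ffun card_bool card_ord natrX mulVf ?expf_neq0 ?pnatr_eq0//=.
    lra.
  have n0 : (k == 0%N :> nat) = false by apply: contraNF kk0 => /eqP k0E; apply/eqP/val_inj.
  have n1 : (k == 1%N :> nat) = false by apply: contraNF kk1 => /eqP k1E; apply/eqP/val_inj.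
  under eq_bigr do rewrite n0 n1 parity_indicator.
  rewrite -mulr_suml big_split /= -mulr_sumr sum_set_chi -cards_eq0 card_edge !mulr0.
  rewrite sumr_const card_ffun card_bool card_ord natrX !addr0.
  by rewrite mulrA mulVf ?expf_neq0 ?pnatr_eq0.
have one_k (k' : 'I_m) : \sum_(k < m) (k == k')%:R = 1 :> R.
  rewrite (bigD1 k')//= eqxx big1 ?addr0// => k /negPf ->; by [].
rewrite -mulr_suml !big_split /= !one_k sumr_const card_ord.
by field.
Qed.

End TwoBitTheory.

(** * Optimal success probability and the cases of six and eight bits *)

Lemma optimal_successE (R : realType) (n : nat) : ~~ odd n -> (1 < n./2)%N ->
  is_Rcyc n (2 / (n./2)%:R : R) ->
  optimal_success R n = (1 + 2 / (n./2)%:R) / 2.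
Proof.
move=> en m1 [_ ub]; have m0 := ltnW m1.
(* The edge of vertex [0] is chosen in every matching, which gives the common left end that the
   two-bit protocol requires. *)
have /choice[p pP] : forall k : 'I_n./2, exists p : 'I_n * 'I_n,
    cyclic_edge k p /\ nat_of_ord p.1 = 0%N.
  by move=> k; have [p pk p1] := exists_cyclic_edge k en m0; exists p.
have pc (k : 'I_n./2) : cyclic_edge k (p k) by case: (pP k).
have pl k l : (p k).1 = (p l).1.
  by apply: val_inj; rewrite /= (pP k).2 (pP l).2.
rewrite /optimal_success; set A := (X in sup X).
have A_ub : ubound A ((1 + 2 / (n./2)%:R) / 2).
  move=> _ [T [Q [[M Mn] Qo ->]]]; apply: (success_le Mn Qo en m0) => g gf.
  by apply: ub; exists g.
have A_in : A ((1 + 2 / (n./2)%:R) / 2).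
  exists (two_bit_theory R pc), (two_bit_protocol R pc m1).
  split; [|exact: two_bit_oblivious|by rewrite two_bit_success].
  by exists (two_bit_model R pc); exact: two_bit_model_noncontextual.
(* The bound is attained, so the set is nonempty and bounded and [sup] is a genuine supremum. *)
apply/le_anti/andP; split; first by apply: ge_sup => //; eexists; exact: A_in.
by apply: ub_le_sup => //; eexists; exact: A_ub.
Qed.

Theorem mainTheorem6 (R : realType) :
  [/\ is_Rcyc 6 (2 / 3 : R),
      is_Rcyc 8 (1 / 2 : R),
      optimal_success R 6 = 5 / 6 &
      optimal_success R 8 = 3 / 4].
Proof.
have R6 := Rcyc6 R; have R8 := Rcyc8 R; split=> //.
  by rewrite optimal_successE//=; lra.
rewrite optimal_successE//=; first by lra.
by rewrite (_ : 2 / 4 = 1 / 2 :> R)//; lra.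
Qed.
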